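(* Let $f$ be the hidden signal and let $f_j$ $(1\le j\le M)$ be the randomly translated and dilated noiseless observations of $f$ described in the context, with dilation standard deviation $\eta$. Assume that $Bf\in C^1(\mathbb{R}^2)$. Then $Bf$ can be recovered from $g_\eta(\omega_1,\omega_2)=\mathbb{E}_\tau[(Bf_j)(\omega_1,\omega_2)]$; namely, in polar coordinates $(r,\theta)$ on the frequency plane, $$Bf(r,\theta)=(I-L_{C_0})^{-1}\,C_1\,L_{C_2}\left(4g_\eta(r,\theta)+r\,\frac{\partial g_\eta}{\partial r}(r,\theta)\right).$$
   Context: **Model (noiseless dilation multi-reference alignment).** $f\in L^2(\mathbb{R})$ is a real-valued function and one has $M$ independent observations $$f_j(x)=f\big((1-\tau_j)^{-1}(x-t_j)\big),\qquad 1\le j\le M,$$ where: (i) $\mathrm{supp}(f_j)\subset[-\tfrac12,\tfrac12]$ for all $j$; (ii) $\{t_j\}_{j=1}^M$ are independent samples of a real random variable $t$; (iii) $\{\tau_j\}_{j=1}^M$ are independent samples of a uniformly distributed real random variable $\tau$ with $\mathbb{E}[\tau]=0$ and $\mathrm{Var}(\tau)=\eta^2\le\tfrac1{12}$, $\eta>0$ (so $\tau$ has density $\frac{1}{2\sqrt3\eta}\chi_{[-\sqrt3\eta,\sqrt3\eta]}$). **Bispectrum.** $\hat f(\omega)=\int_{\mathbb{R}}f(x)e^{-i\omega x}\,dx$, and $Bf(\omega_1,\omega_2)=\hat f(\omega_1)\,\hat f^{*}(\omega_2)\,\hat f(\omega_2-\omega_1)$, where $^*$ denotes complex conjugation; $Bf_j$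 is defined in the same way from $f_j$. Set $g_\eta(\omega_1,\omega_2)=\mathbb{E}_\tau[(Bf_j)(\omega_1,\omega_2)]$ (this does not depend on $j$). **Constants and operators.** $$C_0=\frac{1-\sqrt3\eta}{1+\sqrt3\eta},\qquad C_1=2\sqrt3\,\eta,\qquad C_2=\frac1{1+\sqrt3\eta}.$$ For a constant $C$, the dilation operator $L_C$ is $L_Cg(\omega_1,\omega_2)=C^4g(C\omega_1,C\omega_2)$; in polar coordinates, $L_Cg(r,\theta)=C^4g(Cr,\theta)$. $I$ is the identity operator, and $(I-L_{C_0})^{-1}$ denotes the inverse of the operator $I-L_{C_0}$. Functions of $(\omega_1,\omega_2)\in\mathbb{R}^2$ are also written in polar coordinates $(r,\theta)$ of the plane. *)

(* Defs.v *)
From HB Require Import structures.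
From mathcomp Require Import all_boot all_order all_algebra.
From mathcomp Require Import all_classical all_reals all_analysis.
From mathcomp Require Import complex.

Set Implicit Arguments.
Unset Strict Implicit.
Unset Printing Implicit Defensive.

Import Order.TTheory GRing.Theory Num.Theory.
Import numFieldNormedType.Exports.

Local Open Scope classical_set_scope.
Local Open Scope complex_scope.
Local Open Scope ring_scope.

(* The library puts no normed R-module structure on R[i], so integrals,
   expectations, derivatives and continuity of R[i]-valued functions are taken
   componentwise, on real and imaginary parts. *)
Section complex_valued.
Context {R : realType}.

Definition Cintegral d (T : measurableType d) (mu : {measure set T -> \bar R})
    (F : T -> R[i]) : R[i] :=
  (\int[mu]_x complex.Re (F x)) +i* (\int[mu]_x complex.Im (F x)).

Definition Cintegrable d (T : measurableType d)
    (mu : {measure set T -> \bar R}) (F : T -> R[i]) : Prop :=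
  mu.-integrable setT (fun x => (complex.Re (F x))%:E) /\
  mu.-integrable setT (fun x => (complex.Im (F x))%:E).

Definition Cexpectation d (T : measurableType d) (P : probability T R)
    (X : T -> R[i]) : R[i] :=
  fine 'E_P[fun w => complex.Re (X w)]
    +i* fine 'E_P[fun w => complex.Im (X w)].

Definition Cderivable (u : R -> R[i]) (r : R) : Prop :=
  derivable (fun s => complex.Re (u s)) r 1 /\
  derivable (fun s => complex.Im (u s)) r 1.

Definition Cderive1 (u : R -> R[i]) (r : R) : R[i] :=
  derive1 (fun s => complex.Re (u s)) r
    +i* derive1 (fun s => complex.Im (u s)) r.

Definition Ccontinuous (h : R * R -> R[i]) : Prop :=
  continuous (fun p => complex.Re (h p)) /\
  continuous (fun p => complex.Im (h p)).

Definition C1_real (u : R * R -> R) : Prop :=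
  forall v : R * R, v = (1, 0) \/ v = (0, 1) ->
    (forall p, derivable u p v) /\ continuous (fun p => 'D_v u p).

Definition C1_plane (h : R * R -> R[i]) : Prop :=
  C1_real (fun p => complex.Re (h p)) /\ C1_real (fun p => complex.Im (h p)).

End complex_valued.

Section bispectrum.
Context {R : realType}.

Definition expi (y : R) : R[i] := cos y +i* sin y.

Definition fourier (f : R -> R) (w : R) : R[i] :=
  Cintegral lebesgue_measure (fun x => (f x)%:C * expi (- (w * x))).

Definition bispectrum (f : R -> R) (w : R * R) : R[i] :=
  fourier f w.1 * (fourier f w.2)^* * fourier f (w.2 - w.1).

End bispectrum.

Section model.
Context {R : realType}.

Definition observation (f : R -> R) (t tau : R) (x : R) : R :=
  f ((1 - tau)^-1 * (x - t)).

(* The support of an element of L^2, which is defined only almost everywhere: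
   the complement of the largest open set on which f vanishes a.e.  It is
   contained in the closure of [set x | f x != 0], for any representative f. *)
Definition ess_support (f : R -> R) : set R :=
  ~` \bigcup_(U in [set U : set R | open U /\
       {ae lebesgue_measure, forall x, U x -> f x = 0}]) U.

Definition mutually_independent d (Omega : measurableType d)
    (P : probability Omega R) d' (T : measurableType d') (I : finType)
    (X : I -> Omega -> T) : Prop :=
  forall (J : {set I}) (A : I -> set T), (forall i, measurable (A i)) ->
    P (\bigcap_(i in [set` J]) (X i @^-1` A i)) =
    (\prod_(i in J) P (X i @^-1` A i))%E.

Definition identically_distributed d (Omega : measurableType d)
    (P : probability Omega R) (X Y : {RV P >-> R}) : Prop :=
  forall A, measurable A -> distribution P X A = distribution P Y A.

Definition uniformly_distributed d (Omega : measurableType d)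
    (P : probability Omega R) (X : {RV P >-> R}) : Prop :=
  exists (a b : R) (ab : a < b),
    forall A, measurable A -> distribution P X A = uniform_prob ab A.

End model.

Section operators.
Context {R : realType}.

(* Functions of the plane read in polar coordinates.  Here r and theta range
   over all of R: (- r, theta) and (r, theta + pi) name the same point, so
   nothing is added to the values at r >= 0, and the partial derivative in r is
   an ordinary two-sided one, at r = 0 too. *)
Definition polar (h : R * R -> R[i]) (r theta : R) : R[i] :=
  h (r * cos theta, r * sin theta).

Definition dilation (C : R) (h : R * R -> R[i]) (w : R * R) : R[i] :=
  (C ^+ 4)%:C * h (C * w.1, C * w.2).

Definition dilation_polar (C : R) (H : R -> R -> R[i]) (r theta : R) : R[i] :=
  (C ^+ 4)%:C * H (C * r) theta.

Lemma polar_dilation (C : R) (h : R * R -> R[i]) :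
  polar (dilation C h) = dilation_polar C (polar h).
Proof.
by apply/funext => r; apply/funext => th; rewrite /polar /dilation/= !mulrA.
Qed.

Definition id_sub (L : (R -> R -> R[i]) -> R -> R -> R[i])
    (H : R -> R -> R[i]) (r theta : R) : R[i] :=
  H r theta - L H r theta.

(* C^0(R^2), in polar coordinates.  This is the space on which I - L_C is
   inverted, for 0 < C < 1: on all functions of the plane, I - L_C is not
   injective, as r^(-4) (extended by 0 to the origin) is in its kernel. *)
Definition polar_C0 : set (R -> R -> R[i]) := polar @` [set h | Ccontinuous h].

(* The inverse of the operator A : polar_C0 -> polar_C0; meaningful only when A
   is a bijection of polar_C0 onto itself (the default value id is then never
   used). *)
Definition inverse_op (A : (R -> R -> R[i]) -> R -> R -> R[i]) :
  (R -> R -> R[i]) -> R -> R -> R[i] := 'pinv_id polar_C0 A.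

Definition radial_data (G : R -> R -> R[i]) (r theta : R) : R[i] :=
  4%:R * G r theta + r%:C * Cderive1 (fun s => G s theta) r.

Definition scale_op (c : R) (H : R -> R -> R[i]) (r theta : R) : R[i] :=
  c%:C * H r theta.

Definition const0 (eta : R) : R :=
  (1 - Num.sqrt 3 * eta) / (1 + Num.sqrt 3 * eta).
Definition const1 (eta : R) : R := 2 * Num.sqrt 3 * eta.
Definition const2 (eta : R) : R := (1 + Num.sqrt 3 * eta)^-1.

End operators.

(* Main.v *)
Require Import Defs.
From HB Require Import structures.
From mathcomp Require Import all_boot all_order all_algebra.
From mathcomp Require Import all_classical all_reals all_analysis.
From mathcomp Require Import measurable_realfun complex.
From mathcomp Require Import ring lra.

Set Implicit Arguments.
Unset Strict Implicit.
Unset Printing Implicit Defensive.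

Import Order.TTheory GRing.Theory Num.Theory.
Import numFieldNormedType.Exports.

Local Open Scope classical_set_scope.
Local Open Scope complex_scope.
Local Open Scope ring_scope.

(* For [tau <> 1] a change of variables shows that the Fourier transform of
   [f_j] at [w] is [|1 - tau| * exp(- i w t)] times that of [f] at
   [(1 - tau) * w]; the phases cancel in the bispectrum, hence
   [Bf_j(w) = |1 - tau|^3 Bf((1 - tau) w)].  As [tau] is uniform on [[-s, s]]
   with [s = sqrt 3 * eta], along each ray
     [g(r) = (2s)^-1 \int_(1-s)^(1+s) x^3 Bf(x r) dx],
   and differentiating under the integral sign,
     [2s (4 g(r) + r g'(r)) = \int_(1-s)^(1+s) d/dx (x^4 Bf(x r)) dx
                            = (1+s)^4 Bf((1+s) r) - (1-s)^4 Bf((1-s) r)].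
   Dilating by [(1+s)^-1] turns the right-hand side into [(I - L_C0) Bf].
   For [0 < C < 1] the operator [I - L_C] is bijective on continuous functions:
   [h = L_C h] forces [h(w) = C^(4n) h(C^n w) --> 0], and the Neumann series
   [\sum_n C^(4n) h(C^n w)] converges locally uniformly.  The Fourier integrals
   make sense because one observation with bounded support puts the L^2 signal
   [f] in L^1. *)

(** * Continuously differentiable functions of the plane *)

Section plane_C1.
Context {R : realType}.
Implicit Types (u : R * R -> R) (p k : R * R).

Lemma scale_pairD (h a b x y : R) :
  h *: (a, b) + (x, y) = (h * a + x, h * b + y) :> R * R.
Proof. by []. Qed.

(** Stating the intermediate point as an offset no larger than [h], with [h] of either sign, spares
    a case analysis on signs when increments in the plane are taken. *)
Lemma MVT_increment (g dg : R -> R) (a h : R) :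
  (forall x : R, is_derive x 1 g (dg x)) ->
  exists2 c, `|c| <= `|h| & g (a + h) - g a = h * dg (a + c).
Proof.
move=> dgE.
have gc (x y : R) : {within `[x, y], continuous g}.
  apply: continuous_subspaceT => z; apply: differentiable_continuous.
  by apply/derivable1_diffP; have [] := dgE z.
have [h0|h0] := leP 0 h.
  have [c + ->] := @MVT_segment R g dg a (a + h) ltac:(by rewrite lerDl)
    (fun x _ => dgE x) (gc _ _).
  rewrite in_itv/= => /andP[ac ch].
  exists (c - a); last by rewrite [a + (c - a)]addrC subrK [a + h]addrC addrK mulrC.
  by rewrite !ger0_norm// ?subr_ge0// lerBlDl.
have [c + E] := @MVT_segment R g dg (a + h) a ltac:(by rewrite gerDl ltW)
    (fun x _ => dgE x) (gc _ _).
rewrite in_itv/= => /andP[ac ch].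
exists (c - a).
  by rewrite !ler0_norm ?subr_le0// ?(ltW h0)// lerN2 lerBrDl.
rewrite [a + (c - a)]addrC subrK -opprB E; lra.
Qed.

(** The path from [p] to [p + k] runs first vertically, then horizontally; the mean value theorem on
    each leg gives one partial derivative at a point near [p]. *)
Lemma C1_real_increment u p k : C1_real u ->
  exists c : R * R, [/\ `|c.1| <= `|k.1|, `|c.2| <= `|k.2| &
    u (p + k) - u p = k.1 * 'D_(1, 0) u (p.1 + c.1, p.2 + k.2)
                    + k.2 * 'D_(0, 1) u (p.1, p.2 + c.2)].
Proof.
move=> u1.
have d1 (y x : R) : is_derive x 1 (fun x => u (x, y)) ('D_(1, 0) u (x, y)).
  have [/(_ (x, y)) /derivableP[du <-] _] := u1 (1, 0) (or_introl erefl).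
  have E : (fun h : R => h^-1 *: (((fun x => u (x, y)) \o shift x) (h *: 1) - u (x, y)))
     = (fun h : R => h^-1 *: ((u \o shift (x, y)) (h *: (1, 0)) - u (x, y))).
    by apply/funext => h /=; rewrite scale_pairD mulr1 mulr0 add0r [h%:A]mulr1.
  by split; rewrite /derivable /derive E.
have d2 (x y : R) : is_derive y 1 (fun y => u (x, y)) ('D_(0, 1) u (x, y)).
  have [/(_ (x, y)) /derivableP[du <-] _] := u1 (0, 1) (or_intror erefl).
  have E : (fun h : R => h^-1 *: (((fun y => u (x, y)) \o shift y) (h *: 1) - u (x, y)))
     = (fun h : R => h^-1 *: ((u \o shift (x, y)) (h *: (0, 1)) - u (x, y))).
    by apply/funext => h /=; rewrite scale_pairD mulr1 mulr0 add0r [h%:A]mulr1.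
  by split; rewrite /derivable /derive E.
case: p k => [p1 p2] [k1 k2] /=.
have [c1 c1k e1] := MVT_increment p1 k1 (d1 (p2 + k2)).
have [c2 c2k e2] := MVT_increment p2 k2 (d2 p1).
exists (c1, c2); split => //=.
by rewrite -e1 -e2 addrA subrK.
Qed.

(** The epsilon estimate is the little-o expansion of [f] at [x], and uniqueness of the differential
    identifies [df] with it. *)
Lemma is_diff_le (V W : normedModType R) (f : V -> W) (df : {linear V -> W})
    (x : V) : continuous df ->
  (forall e : R, 0 < e ->
     \forall k \near 0, `|f (x + k) - f x - df k| <= e * `|k|) ->
  is_diff x f df.
Proof.
move=> dfc H.
have E : f \o shift x = cst (f x) + df +o_ 0 id.
  apply/eqaddoP => e e0; apply: filterS (H e e0) => k.
  by rewrite /= /cst !fctE /= [k + x]addrC opprD addrA.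
have dE : 'd f x = df :> (V -> W) by exact: diff_unique.
by split => //; apply/diff_locallyP; rewrite dE.
Qed.

(** By the two-leg increment formula, the error of the linear approximation only involves the
    variation of the two partial derivatives near [p]. Their continuity bounds each variation by e /
    2. *)
Lemma C1_real_diff u p : C1_real u ->
  differentiable u p /\ ('d u p = (fun k : R * R =>
    k.1 * 'D_(1, 0) u p + k.2 * 'D_(0, 1) u p) :> (R * R -> R)).
Proof.
move=> u1; pose D1 := 'D_(1, 0) u; pose D2 := 'D_(0, 1) u.
pose df (k : R * R) : R := k.1 * D1 p + k.2 * D2 p.
have dfl : linear df by move=> a x y; rewrite /df /= /GRing.scale /=; ring.
pose dfL : {linear (R * R)%type -> R} :=
  HB.pack df (GRing.isLinear.Build _ _ _ _ df dfl).
have dfc : continuous df.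
  move=> x; apply: cvgD; apply: cvgM; try exact: cvg_cst.
    exact: cvg_fst.
  exact: cvg_snd.
suff [du dE] : is_diff p u dfL by split.
apply: is_diff_le => // e e0.
  have [_ cD1] := u1 (1, 0) (or_introl erefl).
  have [_ cD2] := u1 (0, 1) (or_intror erefl).
  have e20 : 0 < e / 2 by rewrite divr_gt0.
  have /cvgrPdist_le/(_ _ e20)/nbhs_ballP[d1 /= d10 B1] := cD1 p.
  have /cvgrPdist_le/(_ _ e20)/nbhs_ballP[d2 /= d20 B2] := cD2 p.
  have d0 : 0 < Num.min d1 d2 by rewrite lt_min d10.
  near=> k.
  have : `|k| < Num.min d1 d2.
    by near: k; exact: (@nbhs0_lt R (R * R)%type _ d0).
  rewrite [`|k|](prod_normE k) gt_max !lt_min => /andP[/andP[k11 k12] /andP[k21 k22]].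
  have [c [c1k c2k uE]] := C1_real_increment p k u1.
  rewrite uE /= /df.
  have -> : k.1 * 'D_(1, 0) u (p.1 + c.1, p.2 + k.2) + k.2 * 'D_(0, 1) u (p.1, p.2 + c.2)
    - (k.1 * D1 p + k.2 * D2 p) =
    k.1 * (D1 (p.1 + c.1, p.2 + k.2) - D1 p) + k.2 * (D2 (p.1, p.2 + c.2) - D2 p).
    rewrite /D1 /D2; ring.
  rewrite (le_trans (ler_normD _ _))// !normrM.
  have n1 : `|k.1| <= Num.max `|k.1| `|k.2| by rewrite le_max lexx.
  have n2 : `|k.2| <= Num.max `|k.1| `|k.2| by rewrite le_max lexx orbT.
  have b1 : `|D1 (p.1 + c.1, p.2 + k.2) - D1 p| <= e / 2.
    rewrite distrC; apply: B1; split => /=; rewrite /ball /= opprD addrA subrr add0r normrN//.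
    exact: le_lt_trans k11.
  have b2 : `|D2 (p.1, p.2 + c.2) - D2 p| <= e / 2.
    rewrite distrC; apply: B2; split => /=; rewrite /ball /=.
      by rewrite subrr normr0.
    rewrite opprD addrA subrr add0r normrN//.
    exact: le_lt_trans k22.
  rewrite (splitr e) mulrDl; apply: lerD; rewrite mulrC; exact: ler_pM.
Unshelve. all: end_near. Qed.

Lemma C1_real_continuous u : C1_real u -> continuous u.
Proof.
by move=> u1 p; have [du _] := C1_real_diff p u1; exact: differentiable_continuous du.
Qed.

(** [C1_real] only speaks of the two axis directions; differentiability extends this to the
    direction (a, b), and continuity of the partials makes the resulting derivative continuous along
    the ray. *)
Lemma C1_real_ray u (a b : R) : C1_real u ->
  exists2 du : R -> R, continuous du &
    forall s : R, is_derive s 1 (fun s => u (s * a, s * b)) (du s).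
Proof.
move=> u1.
exists (fun s => a * 'D_(1, 0) u (s * a, s * b) + b * 'D_(0, 1) u (s * a, s * b)).
  have cab : continuous (fun s : R => (s * a, s * b)).
    move=> s; have h (x : R) : (fun s : R => s * x) @ s --> s * x.
      by apply: cvgMr_tmp; exact: cvg_id.
    exact: cvg_pair (h a) (h b).
  have [_ cD1] := u1 (1, 0) (or_introl erefl).
  have [_ cD2] := u1 (0, 1) (or_intror erefl).
  move=> s; apply: cvgD; apply: cvgMl_tmp.
    exact: (continuous_comp (cab s) (cD1 _)).
  exact: (continuous_comp (cab s) (cD2 _)).
move=> s; have [du dE] := C1_real_diff (s * a, s * b) u1.
have E : (fun h : R => h^-1 *: (((fun s => u (s * a, s * b)) \o shift s) (h *: 1)
                                  - u (s * a, s * b)))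
   = (fun h : R => h^-1 *: ((u \o shift (s * a, s * b)) (h *: (a, b))
                                  - u (s * a, s * b))).
  by apply/funext => h /=; rewrite scale_pairD [h%:A]mulr1 !mulrDl.
have := diff_derivable (v := (a, b)) du.
have := deriveE (a, b) du.
by rewrite dE /= => <- ?; split; rewrite /derivable /derive E.
Qed.

End plane_C1.

(** * Transfer of integrals *)

Section transfer.
Context d1 d2 (T1 : measurableType d1) (T2 : measurableType d2) (R : realType).
Variables (m1 : {measure set T1 -> \bar R}) (m2 : {measure set T2 -> \bar R}).
Variables (phi : T1 -> T2) (D : set T2) (k : R).
Hypothesis k0 : 0 <= k.
Hypothesis mphi : measurable_fun setT phi.
Hypothesis mD : measurable D.
Hypothesis transfer_ge0 : forall h : T2 -> \bar R, measurable_fun setT h ->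
  (forall x, 0 <= h x)%E ->
  (\int[m1]_x h (phi x) = k%:E * \int[m2]_(x in D) h x)%E.

(** The nonnegative case applied to the absolute value of [h] gives integrability, and applied to
    the positive and negative parts gives the value. It serves twice: for affine substitutions, and
    for expectations under a uniform law. *)
Lemma Rintegral_transfer (h : T2 -> R) : measurable_fun setT h ->
  m2.-integrable D (EFin \o h) ->
  m1.-integrable setT (EFin \o (h \o phi)) /\
  \int[m1]_x h (phi x) = k * \int[m2]_(x in D) h x.
Proof.
move=> mh ih; have mEh : measurable_fun setT (EFin \o h) by exact/measurable_EFinP.
have ihphi : m1.-integrable setT (EFin \o (h \o phi)).
  apply/integrableP; split; first exact: measurableT_comp mEh mphi.
  rewrite (@transfer_ge0 (fun x => `|(h x)%:E|%E))//; last exact: measurableT_comp.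
  by rewrite lte_mul_pinfty//; move/integrableP : ih => [].
split => //.
suff E : (\int[m1]_x (h (phi x))%:E = k%:E * \int[m2]_(x in D) (h x)%:E)%E.
  by rewrite /Rintegral E fineM//; exact: integrable_fin_num.
have -> : (\int[m1]_x (h (phi x))%:E =
    \int[m1]_x ((EFin \o h)^\+ (phi x)) - \int[m1]_x ((EFin \o h)^\- (phi x)))%E.
  by rewrite -[LHS]/(\int[m1]_x ((EFin \o h) \o phi) x)%E integralE funepos_comp funeneg_comp.
have mp : measurable_fun setT (EFin \o h)^\+%E by exact: measurable_funepos.
have mn : measurable_fun setT (EFin \o h)^\-%E by exact: measurable_funeneg.
rewrite (transfer_ge0 mp)// (transfer_ge0 mn)// (integralE m2 D (EFin \o h)).
(* Distributing [k] over the difference is legitimate because the positive part has a finite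
   integral. *)
apply/esym/muleBr => //.
by apply: fin_num_adde_defr; exact: integrable_pos_fin_num.
Qed.

End transfer.

(** * Affine change of variables *)

Section affine_substitution.
Context {R : realType}.
Local Notation mu := (@lebesgue_measure R).
Variables (c t : R).
Hypothesis c0 : c != 0.
Let phi (x : measurableTypeR R) : measurableTypeR R := c^-1 * (x - t).

Let mphi : measurable_fun setT phi.
Proof.
apply: continuous_measurable_fun => x; apply: cvgMl_tmp.
by apply: cvgB; [exact: cvg_id|exact: cvg_cst].
Qed.

(** By uniqueness of Lebesgue measure it suffices that the pushforward, scaled by the inverse of the
    absolute value of [c], gives half-open intervals their length. *)
Lemma pushforward_affine A : measurable A ->
  pushforward mu phi A = (`|c|%:E * mu A)%E.
Proof.
move=> mA.
have cp : 0 < `|c| by rewrite normr_gt0.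
have k0 : 0 <= `|c|^-1 by rewrite invr_ge0.
pose k : {nonneg R} := NngNum k0.
have /(_ mphi) H := @lebesgue_measure_unique R (mscale k (pushforward mu phi)).
rewrite H // => [|X /ocitvP[->|[[a b] /= ab ->]]].
- by rewrite /mscale /= muleA -EFinM divff ?mul1e// gt_eqF.
- by rewrite !measure0.
rewrite /mscale /= /pushforward [in LHS]lebesgue_measure_itv /= lte_fin ab.
have [cp'|cn] : 0 < c \/ c < 0 by move: c0; rewrite neq_lt => /orP[]; [right|left].
  have -> : phi @^-1` `]a, b] = `]c * a + t, c * b + t]%classic.
    apply/seteqP; split=> x /=; rewrite !in_itv/= /phi;
    by rewrite [c^-1 * _]mulrC ltr_pdivlMr// ler_pdivrMr// ltrBrDr lerBlDr
      [a * _]mulrC [b * _]mulrC.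
  rewrite lebesgue_measure_itv/= lte_fin ltrD2r ltr_pM2l// ab gtr0_norm//.
  rewrite -!EFinB -EFinM; congr EFin; by field.
(* A negative [c] exchanges the endpoints and moves the closed end to the left. *)
have -> : phi @^-1` `]a, b] = `[c * b + t, c * a + t[%classic.
  apply/seteqP; split=> x /=; rewrite !in_itv/= /phi;
  by rewrite [c^-1 * _]mulrC ltr_ndivlMr// ler_ndivrMr// ltrBlDr lerBrDr
    [a * _]mulrC [b * _]mulrC andbC.
rewrite lebesgue_measure_itv/= lte_fin ltrD2r ltr_nM2l// ab ltr0_norm//.
rewrite -!EFinB -EFinM; congr EFin; by field.
Qed.

Lemma ge0_integral_affine (h : _ -> \bar R) : measurable_fun [set: measurableTypeR R] h ->
  (forall x, 0 <= h x)%E ->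
  (\int[mu]_x h (c^-1 * (x - t))%R = `|c|%:E * \int[mu]_x h x)%E.
Proof.
move=> mh h0; pose k := NngNum (normr_ge0 c).
have <- : (\int[mscale k mu]_x h x = `|c|%:E * \int[mu]_x h x)%E.
  by rewrite ge0_integral_mscale.
transitivity (\int[pushforward mu phi]_x h x)%E.
  by rewrite ge0_integral_pushforward//.
apply: eq_measure_integral => A mA _; exact: pushforward_affine.
Qed.

Lemma Rintegral_affine (h : R -> R) : mu.-integrable setT (EFin \o h) ->
  mu.-integrable setT (EFin \o (fun x => h (c^-1 * (x - t)))) /\
  \int[mu]_x h (c^-1 * (x - t)) = `|c| * \int[mu]_x h x.
Proof.
move=> ih; apply: (Rintegral_transfer _ mphi) => //.
- by move=> h' mh' h'0; exact: ge0_integral_affine.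
- by have /measurable_EFinP := measurable_int _ ih.
Qed.

End affine_substitution.

(** * Bispectrum of an observation *)

Section fourier_observation.
Context {R : realType}.
Local Notation mu := (@lebesgue_measure R).

Lemma complex_ReM (x y : R[i]) : complex.Re (x * y) =
  complex.Re x * complex.Re y - complex.Im x * complex.Im y.
Proof. by case: x y => [a b] [a' b']. Qed.

Lemma complex_ImM (x y : R[i]) : complex.Im (x * y) =
  complex.Re x * complex.Im y + complex.Im x * complex.Re y.
Proof. by case: x y => [a b] [a' b']. Qed.

Lemma CintegralZl d (T : measurableType d) (nu : {measure set T -> \bar R})
    (k : R[i]) (F : T -> R[i]) : Cintegrable nu F ->
  Cintegral nu (fun x => k * F x) = k * Cintegral nu F.
Proof.
move=> [iRe iIm]; case: k => a b; rewrite /Cintegral.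
have iZ (r : R) (g : T -> R) : nu.-integrable setT (EFin \o g) ->
  nu.-integrable setT (EFin \o (fun x => r * g x)).
  by move=> ig; exact: integrableZl ig.
under eq_Rintegral do rewrite complex_ReM /=.
under [X in _ +i* X = _]eq_Rintegral do rewrite complex_ImM /=.
rewrite RintegralB//; [|exact: iZ iRe|exact: iZ iIm].
rewrite RintegralD//; [|exact: iZ iIm|exact: iZ iRe].
by rewrite !RintegralZl.
Qed.

Lemma expiD (x y : R) : expi (x + y) = expi x * expi y :> R[i].
Proof.
apply/eqP; rewrite eq_complex /= /expi cosD sinD; apply/andP; split; apply/eqP => //=.
by rewrite addrC mulrC [sin x * _]mulrC [cos y * _]mulrC.
Qed.

Lemma fourier_integrable (f : R -> R) (w : R) : mu.-integrable setT (EFin \o f) ->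
  Cintegrable mu (fun x => (f x)%:C * expi (- (w * x))).
Proof.
move=> fi; have /measurable_EFinP mf := measurable_int _ fi.
have mw : measurable_fun [set: measurableTypeR R] (fun x : R => - (w * x)).
  apply: continuous_measurable_fun => x; apply: cvgN; apply: cvgMl_tmp; exact: cvg_id.
split.
  apply: le_integrable fi => //.
    apply/measurable_EFinP; under eq_fun do rewrite complex_ReM /= mul0r subr0.
    apply: measurable_funM => //; apply: measurableT_comp mw.
    by apply: continuous_measurable_fun; exact: continuous_cos.
  move=> x _; rewrite complex_ReM /= mul0r subr0 lee_fin normrM ler_piMr//.
  by rewrite ler_norml cos_geN1 cos_le1.
apply: le_integrable fi => //.
  apply/measurable_EFinP; under eq_fun do rewrite complex_ImM /= mul0r addr0.
  apply: measurable_funM => //; apply: measurableT_comp mw.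
  by apply: continuous_measurable_fun; exact: continuous_sin.
move=> x _; rewrite complex_ImM /= mul0r addr0 lee_fin normrM ler_piMr//.
by rewrite ler_norml sin_geN1 sin_le1.
Qed.

Lemma Cintegral_affine (c t : R) (F : R -> R[i]) : c != 0 -> Cintegrable mu F ->
  Cintegrable mu (fun x => F (c^-1 * (x - t))) /\
  Cintegral mu (fun x => F (c^-1 * (x - t))) = `|c|%:C * Cintegral mu F.
Proof.
move=> c0 [/(Rintegral_affine t c0)[r1 r2] /(Rintegral_affine t c0)[i1 i2]]; split => //.
by rewrite /Cintegral r2 i2; apply/eqP; rewrite eq_complex /= !mul0r subr0 addr0 !eqxx.
Qed.

Lemma fourier_observationE (f : R -> R) (t tau w : R) :
  mu.-integrable setT (EFin \o f) -> 1 - tau != 0 ->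
  fourier (observation f t tau) w =
  `|1 - tau|%:C * expi (- (w * t)) * fourier f ((1 - tau) * w).
Proof.
move=> fi; set c := 1 - tau => c0.
have [i1 i2] := Cintegral_affine t c0 (fourier_integrable (c * w) fi).
(* With y = (x - t) / c one has w x = w t + (c w) y: the first summand is the constant phase, the
   second leaves the Fourier integrand at frequency [c * w]. *)
rewrite mulrAC -i2 mulrC -CintegralZl//; congr Cintegral; apply/funext => x.
rewrite /observation -/c mulrCA -expiD; congr (_ * expi _); field.
exact: c0.
Qed.

Lemma conj_expi (x : R) : (expi x)^* = expi (- x) :> R[i].
Proof. by rewrite /expi cosN sinN. Qed.

Lemma conj_normC (x : R) : (`|x|%:C)^* = `|x|%:C :> R[i].
Proof. by apply/eqP; rewrite eq_complex /= oppr0 !eqxx. Qed.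

Lemma bispectrum_observation (f : R -> R) (t tau : R) (w : R * R) :
  mu.-integrable setT (EFin \o f) -> 1 - tau != 0 ->
  bispectrum (observation f t tau) w =
  (`|1 - tau| ^+ 3)%:C * bispectrum f ((1 - tau) * w.1, (1 - tau) * w.2).
Proof.
move=> fi c0; rewrite /bispectrum /= !fourier_observationE// !rmorphM /=.
rewrite conj_expi conj_normC mulrBr.
(* Conjugation has flipped the sign of the second phase, so the three phases sum to zero. *)
have E : expi (- (w.1 * t)) * expi (- - (w.2 * t)) * expi (- ((w.2 - w.1) * t)) = 1 :> R[i].
  rewrite -!expiD (_ : _ + _ = 0); first by rewrite /expi cos0 sin0.
  by ring.
rewrite -[RHS]mulr1 -E; ring.
Qed.

End fourier_observation.

(** * Integrability of the hidden signal *)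

Section integrable_signal.
Context {R : realType}.
Local Notation mu := (@lebesgue_measure R).

(* Lindelof: the intervals with rational endpoints on which [g] vanishes a.e.
   cover the complement of the essential support. *)
Lemma ess_support_ae (g : R -> R) (K : set R) : ess_support g `<=` K ->
  {ae mu, forall x, ~ K x -> g x = 0}.
Proof.
move=> gK.
pose I (pq : rat * rat) : set R := `]ratr pq.1, ratr pq.2[%classic.
pose good (pq : rat * rat) := {ae mu, forall x, I pq x -> g x = 0}.
(* Codes of rational pairs make the union countable; a code that names no good interval contributes
   the empty set, so every [N n] is negligible. *)
pose N (n : nat) : set R := if unpickle n is Some pq then
  (if `[< good pq >] then I pq `&` [set x | g x <> 0] else set0) else set0.
suff : mu.-negligible (~` [set x | ~ K x -> g x = 0]) by [].
apply: (@negligibleS _ _ _ mu (\bigcup_n N n) (~` [set x | ~ K x -> g x = 0])); last first.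
  apply: negligible_bigcup => n; rewrite /N.
  case: (unpickle n) => [pq|]; last exact: negligible_set0.
  case: asboolP => [h|_]; last exact: negligible_set0.
  by apply: negligibleS h => x /= [Ix gx] /(_ Ix).
move=> x /= /not_implyP[Kx gx].
have : ~ ess_support g x by move=> /gK.
rewrite /ess_support /= => /contrapT[U [oU Ug] Ux].
have /nbhs_ballP[e /= e0 eU] := open_nbhs_nbhs (conj oU Ux).
have [p] := @rat_in_itvoo R (x - e) x ltac:(by rewrite ltrBlDr ltrDl).
rewrite in_itv/= => /andP[p1 p2].
have [q] := @rat_in_itvoo R x (x + e) ltac:(by rewrite ltrDl).
rewrite in_itv/= => /andP[q1 q2].
exists (pickle (p, q)); first by [].
rewrite /N pickleK.
case: asboolP => [_|[]]; first by split => //; rewrite /I /= in_itv/= p2 q1.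
suff : mu.-negligible (~` [set x | I (p, q) x -> g x = 0]) by [].
apply: negligibleS Ug => y /= nIy Uy0; apply: nIy.
rewrite /I /= in_itv/= => /andP[y1 y2].
apply: Uy0; apply: eU; rewrite /ball /= ltr_distlC; apply/andP; split; lra.
Qed.

(** On the bounded interval [g] is dominated by 1 + g^2, which is integrable there; off the interval
    [g] vanishes almost everywhere. Hence the cut-off [g'] is integrable and agrees with [g] almost
    everywhere. *)
Lemma integrable_bounded_ess_support (g : R -> R) (a b : R) :
  measurable_fun [set: measurableTypeR R] g ->
  mu.-integrable setT (EFin \o (fun x => g x ^+ 2)) ->
  ess_support g `<=` `[a, b] -> mu.-integrable setT (EFin \o g).
Proof.
move=> mg g2 /ess_support_ae g0.
pose K : set (measurableTypeR R) := `[a, b]%classic.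
have mK : measurable K by exact: measurable_itv.
pose h := fun x => \1_K x + g x ^+ 2 : R.
have iK : mu.-integrable setT (EFin \o (\1_K : _ -> R)).
  exact: integrable_indic_itv.
have ih : mu.-integrable setT (EFin \o h) by exact: integrableD iK g2.
pose g' := fun x => \1_K x * g x : R.
have mg' : measurable_fun [set: measurableTypeR R] g'.
  by apply: measurable_funM => //; exact: measurable_indic.
have /integrableP[_ ig'] : mu.-integrable setT (EFin \o g').
  apply: le_integrable ih => //; first exact/measurable_EFinP.
  move=> x _; rewrite lee_fin /g' /h indicE.
  have g20 := sqr_ge0 (g x).
  case: (x \in K); rewrite /= ?mulr1n ?mulr0n ?mul1r ?mul0r ?normr0//.
  rewrite [leRHS]ger0_norm; last by rewrite addr_ge0.
  (* Nonnegativity of (g + 1/2)^2 and (g - 1/2)^2 bounds the absolute value of g by g^2 + 1/4. *)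
  rewrite ler_norml; apply/andP; split.
    by have := sqr_ge0 (g x + 1 / 2);
    rewrite (_ : (g x + 1 / 2) ^+ 2 = g x ^+ 2 + g x + 1 / 4);
    [lra|field].
  by have := sqr_ge0 (g x - 1 / 2);
    rewrite (_ : (g x - 1 / 2) ^+ 2 = g x ^+ 2 - g x + 1 / 4);
    [lra|field].
apply/integrableP; split; first exact/measurable_EFinP.
rewrite (@ae_eq_integral _ _ _ mu setT (fun x => `|(g' x)%:E|%E))//.
- by apply: measurableT_comp => //; exact/measurable_EFinP.
- by apply: measurableT_comp => //; exact/measurable_EFinP.
- suff : mu.-negligible (~` [set x | setT x ->
      (abse \o (EFin \o g)) x = `|(g' x)%:E|%E]) by [].
  apply: negligibleS g0 => x /= nH Hx; apply: nH => _; rewrite /g' /= indicE.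
  have [|/negP xK] := boolP (x \in K); first by rewrite mul1r.
  by rewrite mul0r Hx// => Kx; apply: xK; rewrite inE.
Qed.

Lemma integrable_observation (f : R -> R) (t tau a b : R) :
  f \in Lfun mu 2%:E -> 1 - tau != 0 ->
  ess_support (observation f t tau) `<=` `[a, b] ->
  mu.-integrable setT (EFin \o f).
Proof.
move=> f2 c0 supp; set c := 1 - tau in c0.
have mf : measurable_fun [set: measurableTypeR R] f.
  by move: f2; rewrite inE => /andP[]; rewrite inE.
pose g := observation f t tau.
have [g2 _] := Rintegral_affine t c0 (Lfun2_integrable_sqr f2).
have mphi (k s : R) : measurable_fun [set: measurableTypeR R]
    (fun x : measurableTypeR R => k * (x - s) : measurableTypeR R).
  apply: continuous_measurable_fun => x; apply: cvgMl_tmp.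
  by apply: cvgB; [exact: cvg_id|exact: cvg_cst].
have mg : measurable_fun [set: measurableTypeR R] g.
  exact: measurableT_comp mf (mphi c^-1 t).
have ig := integrable_bounded_ess_support mg g2 supp.
have ci0 : c^-1 != 0 by rewrite invr_eq0.
(* This substitution x -> c x + t inverts the one that defines the observation, so integrability
   passes back to [f]. *)
have [+ _] := Rintegral_affine (- (c^-1 * t)) ci0 ig.
apply: eq_integrable => // x _; rewrite /= /g /observation -/c; congr (f _)%:E.
by field.
Qed.

End integrable_signal.

(** * Averaging over uniform dilations *)

Section real_line.
Context {R : realType}.
Local Notation mu := (@lebesgue_measure R).

Lemma is_derive1_mull (y x : R) : is_derive x 1 (fun x : R => y * x) y.
Proof.
have := is_deriveZ y (is_derive_id x (1 : R)).
by rewrite [y *: 1]mulr1.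
Qed.

Lemma is_derive1_mulr (y x : R) : is_derive x 1 (fun x : R => x * y) y.
Proof. by under eq_fun do rewrite mulrC; exact: is_derive1_mull. Qed.

Lemma continuous_itv_integrable (h : R -> R) (a b : R) : continuous h ->
  mu.-integrable `[a, b] (EFin \o h).
Proof.
move=> ch; apply: continuous_compact_integrable; first exact: segment_compact.
exact: continuous_subspaceT.
Qed.

Lemma continuous_itv_bounded (h : R -> R) (K : R) : continuous h ->
  exists2 M : R, 0 <= M & forall x, `|x| <= K -> `|h x| <= M.
Proof.
move=> ch; have : bounded_set (h @` `[- K, K]).
  apply: compact_bounded; apply: continuous_compact; last exact: segment_compact.
  exact: continuous_subspaceT.
case=> M [Mr HM]; exists (`|M| + 1); first by rewrite addr_ge0.
move=> x xK; apply: (HM (`|M| + 1)).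
  by rewrite (le_lt_trans (ler_norm _))// ltrDl.
by exists x => //=; rewrite in_itv/= -ler_norml.
Qed.

End real_line.

Section radial_average.
Context {R : realType}.
Local Notation mu := (@lebesgue_measure R).
Variables (B dB : R -> R) (al be : R).
Hypothesis al0 : 0 < al.
Hypothesis albe : al < be.
Hypothesis cdB : continuous dB.
Hypothesis B1 : forall x : R, is_derive x 1 B (dB x).

Let cB : continuous B.
Proof.
by move=> z; apply: differentiable_continuous; apply/derivable1_diffP; have [] := B1 z.
Qed.

(* Under the integral sign, [4 * G r + r * G' r] is the integral of the
   derivative in [s] of [s ^+ 4 * B (s * r)]. *)
Lemma radial_averageE (r : R) :
  let G := fun r : R => \int[mu]_(s in `[al, be]) (s ^+ 3 * B (s * r)) in
  derivable G r 1 /\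
  4 * G r + r * derive1 G r = be ^+ 4 * B (be * r) - al ^+ 4 * B (al * r).
Proof.
pose f (x y : R) : R := y ^+ 3 * B (y * x).
pose df (x y : R) : R := y ^+ 4 * dB (y * x).
move=> G.
have mulc (x : R) : continuous (fun y : R => y * x).
  by move=> y; apply: cvgMr_tmp; exact: cvg_id.
have expc n : continuous (fun y : R => y ^+ n) by exact: exprn_continuous.
have cf x : continuous (f x).
  move=> y; apply: cvgM; first exact: expc.
  apply: (@continuous_comp _ _ _ (fun z : R => z * x) B); [exact: mulc|exact: cB].
have cdf x : continuous (df x).
  move=> y; apply: cvgM; first exact: expc.
  apply: (@continuous_comp _ _ _ (fun z : R => z * x) dB); [exact: mulc|exact: cdB].
have fx (x y : R) : is_derive x 1 (f ^~ y) (df x y).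
  have d1 : is_derive x 1 (fun x : R => y * x) y by exact: is_derive1_mull.
  have d2 := @is_derive1_comp _ B (fun x : R => y * x) x _ _ (B1 (y * x)) d1.
  rewrite /f; have -> : (fun x0 : R => y ^+ 3 * B (y * x0)) =
    y ^+ 3 \*: (B \o (fun x : R => y * x)) by [].
  apply: is_derive_eq; rewrite /GRing.scale/= /df; ring.
have mI : measurable (`[al, be]%classic : set (measurableTypeR R)) by exact: measurable_itv.
have I0 : `](r - 1), (r + 1)[%classic r.
  by rewrite /= in_itv/= ltrDl ltr01 ltrBlDr ltrDl ltr01.
have intf x : `](r - 1), (r + 1)[%classic x -> mu.-integrable `[al, be] (EFin \o f x).
  by move=> _; exact: continuous_itv_integrable.
have derf x y : `](r - 1), (r + 1)[%classic x -> `[al, be]%classic y -> derivable (f ^~ y) x 1.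
  by move=> _ _; have [] := fx x y.
(* For x within 1 of r and y in [al, be], the product y x has absolute value at most be (|r| + 1),
   and y^4 is at most be^4; the constant be^4 M therefore dominates the parameter derivative. *)
have [M M0 HM] := continuous_itv_bounded (be * (`|r| + 1)) cdB.
have be0 : 0 < be by exact: lt_trans albe.
have G0 y : 0 <= (cst (be ^+ 4 * M) : R -> R) y by rewrite mulr_ge0// exprn_ge0// ltW.
have intG : mu.-integrable `[al, be] (EFin \o (cst (be ^+ 4 * M) : R -> R)).
  by apply: continuous_itv_integrable => x; exact: cvg_cst.
have Gub x y : `](r - 1), (r + 1)[%classic x -> `[al, be]%classic y ->
    `|partial1of2 f x y| <= (cst (be ^+ 4 * M) : R -> R) y.
  rewrite /= !in_itv/= => /andP[x1 x2] /andP[y1 y2].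
  have y0 : 0 <= y by rewrite (le_trans _ y1)// ltW.
  rewrite /partial1of2 derive1E; have [_ ->] := fx x y.
  rewrite normrM ger0_norm ?exprn_ge0// ler_pM ?exprn_ge0//.
    by rewrite lerXn2r// nnegrE// ltW.
  apply: HM; rewrite normrM ger0_norm// ler_pM//.
  have := ler_norm r; have := ler_norm (- r); rewrite normrN ler_norml => ? ?; lra.
have dG := derivable_under_integral mI I0 intf derf G0 intG Gub.
have G' := differentiation_under_integral mI I0 intf derf G0 intG Gub.
split; first exact: dG.
rewrite {2}/G G' (@eq_Rintegral _ _ R mu _ (df r)); last first.
  by move=> y _; rewrite /partial1of2 derive1E; have [_ ->] := fx r y.
rewrite -!RintegralZl//; try exact: (continuous_itv_integrable _ _ (cf r));
  try exact: (continuous_itv_integrable _ _ (cdf r)).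
rewrite -RintegralD//; last 2 first.
- by apply: continuous_itv_integrable => y; apply: cvgMl_tmp; exact: cf.
- by apply: continuous_itv_integrable => y; apply: cvgMl_tmp; exact: cdf.
rewrite /Rintegral.
pose F (y : R) : R := y ^+ 4 * B (y * r).
have dF (y : R) : is_derive y 1 F (4 * f r y + r * df r y).
  have d1 : is_derive y 1 (fun x : R => x * r) r by exact: is_derive1_mulr.
  have d2 := @is_derive1_comp _ B (fun x : R => x * r) y _ _ (B1 (y * r)) d1.
  rewrite /F; have -> : (fun y : R => y ^+ 4 * B (y * r)) =
    ((id : R -> R) ^+ 4) * (B \o (fun x : R => x * r)).
    by apply/funext => z; rewrite !fctE.
  apply: is_derive_eq; rewrite /GRing.scale/= /df /f !fctE.
  transitivity (y ^+ 4 * (dB (y * r) * r) + B (y * r) * (4 * y ^+ 3 * 1)); first by []. ring.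
have cF : continuous F.
  by move=> z; apply: differentiable_continuous; apply/derivable1_diffP; have [] := dF z.
rewrite (@continuous_FTC2 _ _ F)//.
- by apply: continuous_subspaceT => y; apply: cvgD; apply: cvgMl_tmp; [exact: cf|exact: cdf].
- split; first by move=> y _; have [] := dF y.
    exact: cvg_at_right_filter (cF _).
  exact: cvg_at_left_filter (cF _).
- by move=> y _; rewrite derive1E; have [_ ->] := dF y.
Qed.

End radial_average.

(** * Moments and expectations under a uniform law *)

Section uniform_mean.
Context {R : realType}.
Local Notation mu := (@lebesgue_measure R).

Lemma Rintegral_exprn (a b : R) n : a < b ->
  \int[mu]_(x in `[a, b]) x ^+ n = (b ^+ n.+1 - a ^+ n.+1) / n.+1%:R.
Proof.
move=> ab; pose F : R -> R := n.+1%:R^-1 \*: ((id : R -> R) ^+ n.+1).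
have dF (y : R) : is_derive y 1 F (y ^+ n).
  by apply: is_derive_eq; rewrite /GRing.scale/= mulr1 mulrA mulVf ?pnatr_eq0// mul1r.
have FE y : F y = n.+1%:R^-1 * y ^+ n.+1 by rewrite /F !fctE.
have cF : continuous F.
  by move=> z; apply: differentiable_continuous; apply/derivable1_diffP; have [] := dF z.
rewrite /Rintegral (@continuous_FTC2 _ _ F)//.
- by rewrite -EFinB /= !FE -mulrBr mulrC.
- by apply: continuous_subspaceT; exact: exprn_continuous.
- split; first by move=> y _; have [] := dF y.
    exact: cvg_at_right_filter (cF _).
  exact: cvg_at_left_filter (cF _).
- by move=> y _; rewrite derive1E; have [_ ->] := dF y.
Qed.

Context d (Omega : measurableType d) (P : probability Omega R).
Variables (a b : R) (ab : a < b) (X : {RV P >-> R}).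
Hypothesis X_unif : forall A, measurable A -> distribution P X A = uniform_prob ab A.

Lemma Rintegral_uniform (h : R -> R) :
  measurable_fun [set: measurableTypeR R] h ->
  mu.-integrable `[a, b] (EFin \o h) ->
  P.-integrable setT (EFin \o (h \o X)) /\
  \int[P]_w h (X w) = (b - a)^-1 * \int[mu]_(x in `[a, b]) h x.
Proof.
move=> mh ih.
(* [R] and [measurableTypeR R] have the same measurable sets, under different
   displays. *)
have mX : measurable_fun [set: Omega] (X : Omega -> measurableTypeR R).
  by move=> mU Y mY; exact: (measurable_funPT X mU Y mY).
apply: (@Rintegral_transfer _ _ _ _ _ P mu X) => //.
- by rewrite invr_ge0 subr_ge0 ltW.
- move=> h' mh' h'0; rewrite -integral_uniform//.
  have -> : (\int[P]_x h' (X x) =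
      \int[pushforward P (X : Omega -> measurableTypeR R)]_x h' x)%E.
    by rewrite ge0_integral_pushforward.
  by apply: eq_measure_integral => A mA _; exact: X_unif.
Qed.

(** The mean is (a + b) / 2, so the interval is symmetric; the second moment is then b^2 / 3, which
    must equal v^2. *)
Lemma uniform_expectation_variance (v : R) : 0 < v ->
  ('E_P[X] = 0)%E -> ('V_P[X] = (v ^+ 2)%R%:E)%E ->
  a = - (Num.sqrt 3 * v) /\ b = Num.sqrt 3 * v.
Proof.
move=> v0 E0 V0.
have cid : continuous (id : R -> R) by move=> x; exact: cvg_id.
have csq : continuous (fun x : R => x ^+ 2) by exact: exprn_continuous.
have ba0 : b - a != 0 by rewrite subr_eq0 gt_eqF.
have e1 : a + b = 0.
  have [_] := Rintegral_uniform (continuous_measurable_fun cid)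
    (continuous_itv_integrable a b cid).
  rewrite /Rintegral; move: E0; rewrite unlock => -> /=.
  under eq_integral do rewrite -[X in X%:E]expr1.
  rewrite -[fine _]/(\int[mu]_(x in `[a, b]) x ^+ 1) Rintegral_exprn//.
  move=> /esym/eqP; rewrite mulf_eq0 invr_eq0 (negbTE ba0)/= mulf_eq0.
  rewrite invr_eq0 pnatr_eq0 orbF => /eqP h.
  apply: (mulfI ba0); rewrite mulr0 -h; ring.
have e2 : b ^+ 2 = 3 * v ^+ 2.
  have [_] := Rintegral_uniform (continuous_measurable_fun csq)
    (continuous_itv_integrable a b csq).
  rewrite Rintegral_exprn// /Rintegral.
  move: V0; rewrite /variance unlock E0 /= unlock => VE.
  have -> : (\int[P]_x (X x ^+ 2)%:E = (v ^+ 2)%R%:E)%E.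
    rewrite -VE; apply: eq_integral => x _; congr EFin.
    by rewrite !fctE /= subr0 expr2.
  rewrite /= => ->; have -> : a = - b by apply/eqP; rewrite -addr_eq0 e1.
  by field; move: ba0; have -> : a = - b by apply/eqP; rewrite -addr_eq0 e1.
have b0 : 0 < b by move: ab e1; lra.
have bE : b = Num.sqrt 3 * v.
  apply/eqP; rewrite -(@eqrXn2 _ 2)//; last 2 first.
  - exact: ltW.
  - by rewrite mulr_ge0// ?sqrtr_ge0// ltW.
  by rewrite exprMn sqr_sqrtr// e2.
by split => //; rewrite -bE; apply/eqP; rewrite -addr_eq0 e1.
Qed.

End uniform_mean.

Section dilated_mean.
Context {R : realType} d (Omega : measurableType d) (P : probability Omega R).
Local Notation mu := (@lebesgue_measure R).
Variables (s : R) (s0 : - s < s) (s1 : s < 1) (X : {RV P >-> R}).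
Hypothesis X_unif : forall A, measurable A -> distribution P X A = uniform_prob s0 A.

Lemma dilated_mean (v : R -> R) (k : R) (Y : Omega -> R) : continuous v ->
  (forall w, Y w = if X w == 1 then k else `|1 - X w| ^+ 3 * v (1 - X w)) ->
  P.-integrable setT (EFin \o Y) /\
  fine 'E_P[Y] =
    (2 * s)^-1 * \int[mu]_(x in `[(1 - s), (1 + s)]) (x ^+ 3 * v x).
Proof.
move=> cv YE.
pose psi (x : R) := `|1 - x| ^+ 3 * v (1 - x).
pose h (x : R) := if x == 1 then k else psi x.
have cB : continuous (fun x : R => 1 - x).
  by move=> x; apply: cvgB; [exact: cvg_cst|exact: cvg_id].
have cpsi : continuous psi.
  move=> x; apply: cvgM.
    have : continuous (fun y : R => y ^+ 3) by exact: exprn_continuous.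
    move=> c3; apply: (@continuous_comp _ _ _ (fun x : R => `|1 - x|) (fun y => y ^+ 3)).
      by apply: cvg_norm; exact: cB.
    exact: c3.
  by apply: (@continuous_comp _ _ _ (fun x : R => 1 - x) v); [exact: cB|exact: cv].
have YhX : Y = h \o X by apply/funext => w; rewrite YE.
have mh : measurable_fun [set: measurableTypeR R] h.
  apply: measurable_fun_if => //.
  - exact: measurable_fun_eqr.
  - by apply: measurable_funTS; apply: continuous_measurable_fun.
have hpsi : {in `[- s, s]%classic, h =1 psi}.
  move=> x; rewrite inE /= in_itv/= => /andP[x1 x2].
  by rewrite /h ifF//; apply/negbTE; rewrite lt_eqF// (le_lt_trans x2).
have ih : mu.-integrable `[- s, s] (EFin \o h).
  have := continuous_itv_integrable (- s) s cpsi.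
  by apply: eq_integrable => // x xs; rewrite /= hpsi.
have [i1 i2] := Rintegral_uniform X_unif mh ih.
split; first by rewrite YhX.
rewrite unlock YhX -[LHS]/(\int[P]_w h (X w)) i2 opprK -mulr2n -[s *+ 2]mulr_natl.
congr (_ * _).
pose H (x : R) := x ^+ 3 * v x.
pose HI := H \_ `[1 - s, 1 + s].
have cH : continuous H.
  by move=> x; apply: cvgM; [exact: exprn_continuous|exact: cv].
have iHI : mu.-integrable setT (EFin \o HI).
  rewrite /HI -restrict_EFin; apply/integrable_restrict => //.
  by rewrite setTI; exact: continuous_itv_integrable.
have N1 : (-1 : R) != 0 by rewrite oppr_eq0 oner_eq0.
(* Taking c = -1 and t = 1 in the affine substitution gives the reflection x -> 1 - x. *)
have [_ +] := Rintegral_affine 1 N1 iHI.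
rewrite normrN normr1 mul1r => E.
have -> : \int[mu]_(x in `[(1 - s), (1 + s)]) (x ^+ 3 * v x) = \int[mu]_x HI x.
  by rewrite Rintegral_mkcond.
rewrite -E.
rewrite Rintegral_mkcond; apply: eq_Rintegral => x _.
rewrite invrN invr1 mulN1r opprB /HI !patchE.
have -> : (1 - x \in `[1 - s, 1 + s]%classic) = (x \in `[- s, s]%classic).
  by apply/idP/idP; rewrite !inE /= !in_itv/= => /andP[? ?]; apply/andP; split; lra.
case: ifPn => // xs; rewrite hpsi// /psi /H ger0_norm//.
by move: xs; rewrite inE /= in_itv/= => /andP[_ xs]; move: s1 xs; lra.
Qed.

End dilated_mean.

(** * Inversion of [I - L_C] *)

Lemma continuous_scale_pair (R : realType) (a : R) :
  continuous (fun w : R * R => (a * w.1, a * w.2)).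
Proof.
move=> w.
have h1 : (fun w : R * R => a * w.1) @ w --> a * w.1.
  by apply: cvgMl_tmp; exact: cvg_fst.
have h2 : (fun w : R * R => a * w.2) @ w --> a * w.2.
  by apply: cvgMl_tmp; exact: cvg_snd.
exact: cvg_pair h1 h2.
Qed.

Section neumann.
Context {R : realType}.
Variable C : R.
Hypothesis C0 : 0 < C.
Hypothesis C1 : C < 1.

Let q0 : 0 <= C ^+ 4. Proof. by rewrite exprn_ge0// ltW. Qed.
Let q1 : C ^+ 4 < 1. Proof. by rewrite exprn_ilt1// ltW. Qed.
Let qn0 n : 0 <= (C ^+ 4) ^+ n. Proof. by rewrite exprn_ge0. Qed.
Let Cn0 n : 0 <= C ^+ n. Proof. by rewrite exprn_ge0// ltW. Qed.
Let Cn1 n : C ^+ n <= 1. Proof. by rewrite exprn_ile1// ltW. Qed.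

Let cvg_q : (C ^+ 4) ^+ n @[n --> \oo] --> (0 : R).
Proof. by apply: cvg_expr; rewrite ger0_norm. Qed.

Let cvg_C : C ^+ n @[n --> \oo] --> (0 : R).
Proof. by apply: cvg_expr; rewrite ger0_norm// ltW. Qed.

(** Iterating the equation moves the argument to the origin, where continuity keeps the values
    convergent, while the factor C^(4n) tends to zero. *)
Lemma dilation_fixed_eq0 (d : R -> R) : {for 0, continuous d} ->
  (forall r, d r = C ^+ 4 * d (C * r)) -> forall r, d r = 0.
Proof.
move=> cd dE r.
have dn n : d r = (C ^+ 4) ^+ n * d (C ^+ n * r).
  elim: n => [|n IH]; first by rewrite !expr0 !mul1r.
  by rewrite IH dE mulrA -exprSr mulrA -exprS.
have cr : C ^+ n * r @[n --> \oo] --> (0 : R).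
  by rewrite -(mul0r r); apply: cvgMr_tmp.
have cdr : d (C ^+ n * r) @[n --> \oo] --> d 0.
  by apply: (@cvg_comp _ _ _ (fun n => C ^+ n * r) d _ (nbhs (0 : R))).
have : (C ^+ 4) ^+ n * d (C ^+ n * r) @[n --> \oo] --> 0 * d 0 by exact: cvgM.
rewrite mul0r; under eq_cvg do rewrite -dn.
move=> /cvg_lim <- //; apply/esym/cvg_lim => //; exact: cvg_cst.
Qed.

Lemma continuous_box_bounded (k : R * R -> R) (N : R) : continuous k ->
  exists2 M : R, 0 <= M & forall w, `|w.1| <= N -> `|w.2| <= N -> `|k w| <= M.
Proof.
move=> ck; have : bounded_set (k @` (`[- N, N] `*` `[- N, N])).
  apply: compact_bounded; apply: continuous_compact.
    exact: continuous_subspaceT.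
  by apply: compact_setX; exact: segment_compact.
case=> M [Mr HM]; exists (`|M| + 1); first by rewrite addr_ge0.
move=> w w1 w2; apply: (HM (`|M| + 1)).
  by rewrite (le_lt_trans (ler_norm _))// ltrDl.
by exists w => //; split; rewrite /= in_itv/= -ler_norml.
Qed.

(** The solution is the Neumann series. On a box centred at the origin its terms are dominated by a
    geometric series of ratio C^4, because multiplication by C^n maps the box into itself; this
    uniform control makes the sum continuous. *)
Lemma dilation_equation (k : R * R -> R) : continuous k ->
  exists2 H : R * R -> R, continuous H &
    forall w, H w - C ^+ 4 * H (C * w.1, C * w.2) = k w.
Proof.
move=> ck.
pose T (w : R * R) n : R := (C ^+ 4) ^+ n * k (C ^+ n * w.1, C ^+ n * w.2).
have Tbound N : exists2 M : R, 0 <= M &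
    forall w, `|w.1| <= N -> `|w.2| <= N -> forall n, `|T w n| <= M * (C ^+ 4) ^+ n.
  have [M M0 HM] := continuous_box_bounded N ck; exists M => // w w1 w2 n.
  rewrite /T normrM ger0_norm// mulrC ler_wpM2r//; apply: HM => /=.
    by rewrite normrM ger0_norm// (le_trans _ w1)// ler_piMl.
  by rewrite normrM ger0_norm// (le_trans _ w2)// ler_piMl.
have Tcvg w : cvgn (series (T w)).
  pose N := Num.max `|w.1| `|w.2|.
  have [M M0 HM] := Tbound N.
  apply: normed_cvg; apply: (@series_le_cvg _ _ (geometric M (C ^+ 4))).
  - by move=> n; exact: normr_ge0.
  - by move=> n; rewrite /geometric /= mulr_ge0.
  - by move=> n; apply: HM; rewrite /N le_max lexx ?orbT.
  - by apply: is_cvg_geometric_series; rewrite ger0_norm.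
pose H w := limn (series (T w)).
have Hcvg w : series (T w) n @[n --> \oo] --> H w by exact: Tcvg.
have HE w : H w = k w + C ^+ 4 * H (C * w.1, C * w.2).
  (* Splitting off the term of index 0 leaves the same series at the contracted point; passing to
     the limit yields the equation. *)
  have S n : series (T w) n.+1 = k w + C ^+ 4 * series (T (C * w.1, C * w.2)) n.
    rewrite /series /= big_nat_recl// {1}/T !expr0 !mul1r -surjective_pairing.
    congr (_ + _); rewrite big_distrr /=; apply: eq_bigr => i _.
    by rewrite /T /= !mulrA -exprS -!exprSr.
  have h1 : series (T w) n.+1 @[n --> \oo] --> H w by rewrite (cvg_shiftS (series (T w))).
  have h2 : series (T w) n.+1 @[n --> \oo] --> k w + C ^+ 4 * H (C * w.1, C * w.2).
    under eq_cvg do rewrite S.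
    by apply: cvgD; [exact: cvg_cst|apply: cvgMl_tmp; exact: Hcvg].
  by rewrite -(cvg_lim _ h1)// (cvg_lim _ h2).
exists H; last by move=> w; rewrite {1}HE addrK.
(* Iterating the equation bounds the tail of the series by [H] itself. *)
have HSn w n : H w = series (T w) n + (C ^+ 4) ^+ n * H (C ^+ n * w.1, C ^+ n * w.2).
  elim: n => [|n IH].
    by rewrite /series /= big_geq// add0r !expr0 !mul1r -surjective_pairing.
  rewrite IH [H (_, _)]HE /= /series /= big_nat_recr//= mulrDr addrA -/(T w n).
  by rewrite mulrA -exprSr !mulrA -exprS.
have Hbound N : exists2 M : R, 0 <= M &
    forall w, `|w.1| <= N -> `|w.2| <= N -> `|H w| <= M.
  have [M M0 HM] := Tbound N; exists (M / (1 - C ^+ 4)).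
    by rewrite divr_ge0// subr_ge0 ltW.
  move=> w w1 w2.
  have nH : `|series (T w) n| @[n --> \oo] --> `|H w| by apply: cvg_norm; exact: Hcvg.
  rewrite -(cvg_lim _ nH)//; apply: limr_le; first by apply/cvg_ex; exists `|H w|.
  apply: nearW => n; rewrite /series /= (le_trans (ler_norm_sum _ _ _))//.
  apply: le_trans (_ : series (geometric M (C ^+ 4)) n <= _).
    by rewrite /series /=; apply: ler_sum => i _; exact: HM.
  by apply: geometric_le_lim => //; rewrite ?ger0_norm// exprn_gt0.
have cS n : continuous (fun w => series (T w) n).
  elim: n => [|n IH].
    rewrite [X in continuous X](_ : _ = cst 0); first exact: cst_continuous.
    by apply/funext => w; rewrite /series /= big_geq.
  rewrite [X in continuous X](_ : _ = (fun w => series (T w) n + T w n)); last first.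
    by apply/funext => w; rewrite /series /= big_nat_recr.
  move=> w; apply: cvgD; first exact: IH.
  apply: cvgMl_tmp.
  apply: (@continuous_comp _ _ _ (fun w : R * R => (C ^+ n * w.1, C ^+ n * w.2)) k).
    exact: continuous_scale_pair.
  exact: ck.
move=> w; apply/cvgrPdist_le => e e0.
(* The extra 1 makes the box contain the unit ball around [w], so one tail bound serves [w] and all
   nearby [v]. *)
pose N := Num.max `|w.1| `|w.2| + 1.
have [M M0 HM] := Hbound N.
have e30 : 0 < e / 3 by rewrite divr_gt0.
have qM : (C ^+ 4) ^+ n * M @[n --> \oo] --> (0 : R) by rewrite -(mul0r M); apply: cvgMr_tmp.
have /cvgr0_norm_le /(_ _ e30) [n _ Hn] := qM.
have {}Hn := Hn n (leqnn n).
have tail v : `|v.1| <= N -> `|v.2| <= N -> `|H v - series (T v) n| <= e / 3.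
  move=> v1 v2; rewrite (HSn v n) addrAC subrr add0r.
  apply: le_trans Hn; rewrite !normrM ler_wpM2l//.
  rewrite [leRHS]ger0_norm//; apply: HM => /=.
    by rewrite normrM ger0_norm// (le_trans _ v1)// ler_piMl.
  by rewrite normrM ger0_norm// (le_trans _ v2)// ler_piMl.
have /cvgrPdist_le/(_ _ e30) Sn := cS n w.
near=> v.
have [h1 h2] : ball w (1 : R) v by near: v; exact: (@nbhsx_ballx R (R * R)%type w 1 ltr01).
rewrite /ball /= in h1 h2.
have v1 : `|v.1| <= N.
  rewrite -[v.1](subrK w.1) (le_trans (ler_normD _ _))// addrC lerD//.
    by rewrite le_max lexx.
  by rewrite distrC ltW.
have v2 : `|v.2| <= N.
  rewrite -[v.2](subrK w.2) (le_trans (ler_normD _ _))// addrC lerD//.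
    by rewrite le_max lexx orbT.
  by rewrite distrC ltW.
have w1 : `|w.1| <= N by rewrite /N ler_wpDr// le_max lexx.
have w2 : `|w.2| <= N by rewrite /N ler_wpDr// le_max lexx orbT.
have -> : H w - H v = (H w - series (T w) n) + (series (T w) n - series (T v) n)
  - (H v - series (T v) n) by ring.
have -> : e = e / 3 + e / 3 + e / 3 by field.
rewrite (le_trans (ler_normB _ _))// lerD//; last exact: tail.
rewrite (le_trans (ler_normD _ _))// lerD//; first exact: tail.
by near: v.
Unshelve. all: end_near. Qed.

End neumann.

Section radial_operator.
Context {R : realType}.
Variable C : R.
Hypothesis C0 : 0 < C.
Hypothesis C1 : C < 1.
Local Notation A := (id_sub (dilation_polar C)).

Lemma id_sub_polar (h : R * R -> R[i]) :
  A (polar h) = polar (fun w => h w - dilation C h w).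
Proof. by rewrite /id_sub -polar_dilation. Qed.

Lemma Re_dilation (h : R * R -> R[i]) w :
  complex.Re (h w - dilation C h w) =
  complex.Re (h w) - C ^+ 4 * complex.Re (h (C * w.1, C * w.2)).
Proof.
have -> : complex.Re (h w - dilation C h w) = complex.Re (h w) - complex.Re (dilation C h w).
  by case: (h w) (dilation C h w) => [a b] [c d].
by rewrite /dilation complex_ReM /= mul0r subr0.
Qed.

Lemma Im_dilation (h : R * R -> R[i]) w :
  complex.Im (h w - dilation C h w) =
  complex.Im (h w) - C ^+ 4 * complex.Im (h (C * w.1, C * w.2)).
Proof.
have -> : complex.Im (h w - dilation C h w) = complex.Im (h w) - complex.Im (dilation C h w).
  by case: (h w) (dilation C h w) => [a b] [c d].
by rewrite /dilation complex_ImM /= mul0r addr0.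
Qed.

Lemma polar_C0_id_sub (H : R -> R -> R[i]) : polar_C0 H -> polar_C0 (A H).
Proof.
move=> [h [cRe cIm] <-]; rewrite id_sub_polar.
exists (fun w => h w - dilation C h w) => //.
have cC (u : R * R -> R) : continuous u ->
    continuous (fun w => u w - C ^+ 4 * u (C * w.1, C * w.2)).
  move=> cu w; apply: cvgB; first exact: cu.
  apply: cvgMl_tmp.
  apply: (@continuous_comp _ _ _ (fun w : R * R => (C * w.1, C * w.2)) u).
    exact: continuous_scale_pair.
  exact: cu.
split; under eq_fun do rewrite (Re_dilation, Im_dilation); exact: cC.
Qed.

(** Along each ray, the real and imaginary parts of the difference of two functions with the same
    image are continuous and satisfy the homogeneous dilation equation, hence vanish. *)
Lemma id_sub_inj : {in polar_C0 &, injective A}.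
Proof.
move=> _ _ /[!inE] [[h [hRe hIm] <-]] [k [kRe kIm] <-].
rewrite !id_sub_polar => AE; apply/funext => r; apply/funext => th.
have cray : continuous (fun s : R => (s * cos th, s * sin th)).
  move=> s; have f (x : R) : (fun s : R => s * x) @ s --> s * x.
    by apply: cvgMr_tmp; exact: cvg_id.
  exact: cvg_pair (f (cos th)) (f (sin th)).
have E s : h (s * cos th, s * sin th) - dilation C h (s * cos th, s * sin th) =
           k (s * cos th, s * sin th) - dilation C k (s * cos th, s * sin th).
  by have := congr1 (fun F => F s th) AE.
pose ray (u : R * R -> R) s := u (s * cos th, s * sin th).
have cr u : continuous u -> continuous (ray u).
  move=> cu s; exact: (continuous_comp (cray s) (cu _)).
rewrite /polar; apply/eqP; rewrite eq_complex; apply/andP; split; rewrite -subr_eq0; apply/eqP.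
  apply: (@dilation_fixed_eq0 _ C C0 C1
    (fun s => ray (fun w => complex.Re (h w)) s - ray (fun w => complex.Re (k w)) s)).
    by apply: cvgB; exact: cr.
  move=> s; have := congr1 (@complex.Re R) (E s); rewrite !Re_dilation /ray /= !mulrA; lra.
apply: (@dilation_fixed_eq0 _ C C0 C1
  (fun s => ray (fun w => complex.Im (h w)) s - ray (fun w => complex.Im (k w)) s)).
  by apply: cvgB; exact: cr.
move=> s; have := congr1 (@complex.Im R) (E s); rewrite !Im_dilation /ray /= !mulrA; lra.
Qed.

(** The factor C^4 is real, so for surjectivity the equation splits into two real ones, each solved
    by its own Neumann series. *)
Lemma id_sub_bij : set_bij polar_C0 polar_C0 A.
Proof.
split; [exact: polar_C0_id_sub|exact: id_sub_inj|].
move=> _ [k [kRe kIm] <-].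
have [h1 c1 E1] := dilation_equation C0 C1 kRe.
have [h2 c2 E2] := dilation_equation C0 C1 kIm.
exists (polar (fun w => h1 w +i* h2 w)).
  by exists (fun w => h1 w +i* h2 w).
rewrite id_sub_polar; congr polar; apply/funext => w.
by apply/eqP; rewrite eq_complex Re_dilation Im_dilation /= E1 E2 !eqxx.
Qed.

End radial_operator.

(** * Recovery of the bispectrum *)

Section recovery.
Context {R : realType}.
Local Notation mu := (@lebesgue_measure R).

Lemma Re_realM (x : R) (z : R[i]) : complex.Re (x%:C * z) = x * complex.Re z.
Proof. by rewrite complex_ReM /= mul0r subr0. Qed.

(** The left-hand side has the shape of the recovery data, with [const1] as [c] and the fourth power
    of [const2] as [k]; all coefficients are real, so the real part passes through. *)
Lemma Re_radial_data (c k r : R) (u : R -> R[i]) :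
  complex.Re (c%:C * (k%:C * (4%:R * u r + r%:C * Cderive1 u r))) =
  c * (k * (4 * complex.Re (u r) + r * derive1 (fun s => complex.Re (u s)) r)).
Proof.
have D (y z : R[i]) : complex.Re (y + z) = complex.Re y + complex.Re z.
  by case: y z => [? ?] [? ?].
by rewrite !Re_realM D Re_realM [4%:R * _]mulr_natl raddfMn [4 * complex.Re _]mulr_natl.
Qed.

Lemma Im_realM (x : R) (z : R[i]) : complex.Im (x%:C * z) = x * complex.Im z.
Proof. by rewrite complex_ImM /= mul0r addr0. Qed.

Lemma Im_radial_data (c k r : R) (u : R -> R[i]) :
  complex.Im (c%:C * (k%:C * (4%:R * u r + r%:C * Cderive1 u r))) =
  c * (k * (4 * complex.Im (u r) + r * derive1 (fun s => complex.Im (u s)) r)).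
Proof.
have D (y z : R[i]) : complex.Im (y + z) = complex.Im y + complex.Im z.
  by case: y z => [? ?] [? ?].
by rewrite !Im_realM D Im_realM [4%:R * _]mulr_natl raddfMn [4 * complex.Im _]mulr_natl.
Qed.

(** This is the recovery identity for one real component along one ray, to be applied to the real
    and imaginary parts of the bispectrum. The factor 2 s cancels the density of the uniform law. *)
Lemma C1_real_ray_average (u : R * R -> R) (s th : R) : C1_real u ->
  0 < s -> s < 1 ->
  let G (r : R) := (2 * s)^-1 * \int[mu]_(x in `[(1 - s), (1 + s)])
    (x ^+ 3 * u (x * (r * cos th), x * (r * sin th))) in
  (forall r, derivable G r 1) /\
  forall r, 2 * s * ((1 + s)^-1 ^+ 4 *
      (4 * G ((1 + s)^-1 * r) + (1 + s)^-1 * r * derive1 G ((1 + s)^-1 * r))) =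
    u (r * cos th, r * sin th) - ((1 - s) / (1 + s)) ^+ 4 *
    u ((1 - s) / (1 + s) * (r * cos th), (1 - s) / (1 + s) * (r * sin th)).
Proof.
move=> u1 s0 s1 G.
have [du cdu duE] := C1_real_ray (cos th) (sin th) u1.
have al0 : 0 < 1 - s by lra.
have albe : 1 - s < 1 + s by lra.
pose G0 (r : R) := \int[mu]_(x in `[(1 - s), (1 + s)])
  (x ^+ 3 * (fun z => u (z * cos th, z * sin th)) (x * r)).
have GE : G = (2 * s)^-1 \*: G0.
  apply/funext => r; rewrite /G /G0; congr (_ * _); apply: eq_Rintegral => x _.
  by rewrite !mulrA.
have G0E := radial_averageE al0 albe cdu duE.
have dG r : derivable G r 1 /\ derive1 G r = (2 * s)^-1 * derive1 G0 r.
  have [dG0 _] := G0E r; rewrite GE; split; first exact: derivableZ.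
  by rewrite !derive1E deriveZ.
split; first by move=> r; have [] := dG r.
move=> r; set rho := _ * r; have [_ ->] := dG rho; rewrite GE.
have [_ E] := G0E rho.
have be0 : 1 + s != 0 by apply: lt0r_neq0; lra.
have s20 : s != 0 by apply: lt0r_neq0.
(* Evaluating at rho = r / (1 + s) sends the outer endpoint to r and the inner one to (1 - s) / (1 +
   s) times r, which is where [const0] comes from. *)
have r1 : (1 + s) * rho = r by rewrite /rho mulrA divff// mul1r.
have r2 : (1 - s) * rho = (1 - s) / (1 + s) * r by rewrite /rho mulrA.
rewrite r1 r2 in E.
transitivity ((1 + s)^-1 ^+ 4 * (4 * G0 rho + rho * derive1 G0 rho)).
  by rewrite /= /GRing.scale/=; field; rewrite be0.
rewrite E !mulrA mulrBr mulrA -exprMn mulVf// expr1n mul1r.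
by rewrite mulrA -exprMn [_^-1 * _]mulrC.
Qed.

End recovery.

Theorem theorem1 (R : realType) (d : measure_display)
    (Omega : measurableType d) (P : probability Omega R) (M : nat)
    (f : R -> R) (eta : R)
    (t tau : {RV P >-> R}) (t_ tau_ : 'I_M -> {RV P >-> R})
    (fL2 : f \in Lfun lebesgue_measure 2%:E)
    (obs_supp : {ae P, forall w, forall j : 'I_M,
       ess_support (observation f (t_ j w) (tau_ j w)) `<=`
         `[- (1 / 2), 1 / 2]})
    (obs_indep : mutually_independent P
       (fun (j : 'I_M) (w : Omega) => (t_ j w, tau_ j w)))
    (t_sample : forall j, identically_distributed (t_ j) t)
    (tau_sample : forall j, identically_distributed (tau_ j) tau)
    (tau_unif : uniformly_distributed tau)
    (tau_mean : ('E_P[tau] = 0)%E)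
    (eta_gt0 : 0 < eta)
    (tau_var : ('V_P[tau] = (eta ^+ 2)%R%:E)%E)
    (eta_small : eta ^+ 2 <= 1 / 12)
    (BfC1 : C1_plane (bispectrum f)) :
  forall j : 'I_M,
  let Bfj := fun (w : Omega) (omega : R * R) =>
    bispectrum (observation f (t_ j w) (tau_ j w)) omega in
  let g := fun omega : R * R => Cexpectation P (fun w => Bfj w omega) in
  let data :=
    scale_op (const1 eta) (dilation_polar (const2 eta) (radial_data (polar g)))
  in
  [/\ forall omega, Cintegrable P (fun w => Bfj w omega),
      forall r theta, Cderivable (fun s => polar g s theta) r,
      polar_C0 data,
      set_bij polar_C0 polar_C0 (id_sub (dilation_polar (const0 eta))) &
      forall r theta,
        polar (bispectrum f) r theta =
        inverse_op (id_sub (dilation_polar (const0 eta))) data r theta].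
Proof.
move=> j Bfj g data.
pose s := Num.sqrt 3 * eta.
have s0 : 0 < s by rewrite mulr_gt0// sqrtr_gt0.
(* As s^2 = 3 eta^2, the bound on eta gives s <= 1/2; dilations in [1 - s, 1 + s] thus stay
   positive. *)
have s2 : s ^+ 2 <= 1 / 4.
  by rewrite exprMn sqr_sqrtr//; move: eta_small; lra.
have s12 : s <= 1 / 2.
  rewrite -(@ler_pXn2r _ 2)// ?nnegrE ?(ltW s0)// ?divr_ge0//.
  by rewrite (le_trans s2)// expr_div_n expr1n; lra.
have s1 : s < 1 by lra.
have [a [b [ab tau_ab]]] := tau_unif.
have [aE bE] := uniform_expectation_variance tau_ab eta_gt0 tau_mean tau_var.
have {tau_ab} [ss tau_s] : exists ss : - s < s, forall A, measurable A ->
    distribution P (tau_ j) A = uniform_prob ss A.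
  move: ab tau_ab; rewrite aE bE -/s => ss tau_s; exists ss => A mA.
  by rewrite tau_sample// tau_s.
have fi : lebesgue_measure.-integrable setT (EFin \o f).
  have [N [mN PN0 NP]] := obs_supp.
  (* The event that [tau_ j] lies in [-s, s] has probability one, so it is not contained in the null
     set [N]. A sample point outside [N] supplies one observation with bounded support and nonzero
     dilation factor. *)
  have [w [wN ws]] : exists w, ~ N w /\ `[- s, s]%classic (tau_ j w).
    apply: contrapT => /forallNP H.
    pose I : set R := `[- s, s]%classic.
    have mI : measurable (I : set (measurableTypeR R)) by exact: measurable_itv.
    have m1 : measurable (tau_ j @^-1` I).
      by rewrite -[X in measurable X]setTI; exact: (measurable_funPT (tau_ j) measurableT I mI).
    have : (P (tau_ j @^-1` I) <= P N)%E.
      apply: le_measure; rewrite ?inE// => w ws.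
      by apply: contrapT => wN; exact: (H w).
    rewrite PN0 -[P _]/(distribution P (tau_ j) I) (tau_s I mI).
    by rewrite /uniform_prob (integral_uniform_pdf1 ss (@subset_refl _ I)) lee_fin ler10.
  have supp : ess_support (observation f (t_ j w) (tau_ j w)) `<=`
      `[- (1 / 2), 1 / 2].
    by apply: contrapT => ns; apply: wN; apply: NP => /= /(_ j).
  apply: integrable_observation fL2 _ supp.
  by move: ws; rewrite /= in_itv/= => /andP[_ ws]; apply: lt0r_neq0; lra.
(* At [tau = 1] the observation is the constant [f 0], since [0^-1 = 0]; this
   null event matters only for measurability on all of [Omega]. *)
have BfjE w omega : Bfj w omega = if tau_ j w == 1
    then bispectrum (fun=> f 0) omega
    else (`|1 - tau_ j w| ^+ 3)%:C *
      bispectrum f ((1 - tau_ j w) * omega.1, (1 - tau_ j w) * omega.2).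
  rewrite /Bfj; case: eqP => [->|/eqP t1].
    have -> // : observation f (t_ j w) 1 = (fun=> f 0).
    by apply/funext => x; rewrite /observation subrr invr0 mul0r.
  have c0 : 1 - tau_ j w != 0 by rewrite subr_eq0 eq_sym.
  exact: bispectrum_observation.
have [Re1 Im1] := BfC1.
have cBf (u : R * R -> R) omega : C1_real u ->
    continuous (fun x : R => u (x * omega.1, x * omega.2)).
  move=> /C1_real_continuous cu x.
  have h (z : R) : (fun x : R => x * z) @ x --> x * z.
    by apply: cvgMr_tmp; exact: cvg_id.
  apply: (@continuous_comp _ _ _ (fun x : R => (x * omega.1, x * omega.2)) u).
    exact: cvg_pair (h omega.1) (h omega.2).
  exact: cu.
have ReBfj omega w : complex.Re (Bfj w omega) = if tau_ j w == 1
    then complex.Re (bispectrum (fun=> f 0) omega)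
    else `|1 - tau_ j w| ^+ 3 * complex.Re (bispectrum f
      ((1 - tau_ j w) * omega.1, (1 - tau_ j w) * omega.2)).
  by rewrite BfjE; case: ifP => // _; rewrite complex_ReM /= mul0r subr0.
have ImBfj omega w : complex.Im (Bfj w omega) = if tau_ j w == 1
    then complex.Im (bispectrum (fun=> f 0) omega)
    else `|1 - tau_ j w| ^+ 3 * complex.Im (bispectrum f
      ((1 - tau_ j w) * omega.1, (1 - tau_ j w) * omega.2)).
  by rewrite BfjE; case: ifP => // _; rewrite complex_ImM /= mul0r addr0.
have meanRe omega := dilated_mean s1 tau_s (cBf _ omega Re1) (ReBfj omega).
have meanIm omega := dilated_mean s1 tau_s (cBf _ omega Im1) (ImBfj omega).
(* Unification fills the right-hand side with the integral formula, in the form of the average [G]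
   of [C1_real_ray_average]. *)
have gRe r th : complex.Re (polar g r th) = _ := (meanRe (r * cos th, r * sin th)).2.
have gIm r th : complex.Im (polar g r th) = _ := (meanIm (r * cos th, r * sin th)).2.
have gReE th : (fun r => complex.Re (polar g r th)) = _ := funext (gRe ^~ th).
have gImE th : (fun r => complex.Im (polar g r th)) = _ := funext (gIm ^~ th).
have recRe th := C1_real_ray_average th Re1 s0 s1.
have recIm th := C1_real_ray_average th Im1 s0 s1.
have C00 : 0 < const0 eta by rewrite /const0 -/s divr_gt0//; lra.
have C01 : const0 eta < 1 by rewrite /const0 -/s ltr_pdivrMr; lra.
have dataE : data = id_sub (dilation_polar (const0 eta)) (polar (bispectrum f)).
  rewrite id_sub_polar; apply/funext => r; apply/funext => th.
  have c1 : const1 eta = 2 * s by rewrite /const1 -mulrA.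
  have dRe : complex.Re (data r th) = const1 eta * (const2 eta ^+ 4 *
      (4 * complex.Re (polar g (const2 eta * r) th) + const2 eta * r *
        derive1 (fun r => complex.Re (polar g r th)) (const2 eta * r))).
    by rewrite -(Re_radial_data _ _ _ (fun r => polar g r th)).
  have dIm : complex.Im (data r th) = const1 eta * (const2 eta ^+ 4 *
      (4 * complex.Im (polar g (const2 eta * r) th) + const2 eta * r *
        derive1 (fun r => complex.Im (polar g r th)) (const2 eta * r))).
    by rewrite -(Im_radial_data _ _ _ (fun r => polar g r th)).
  rewrite gReE gRe c1 in dRe; rewrite gImE gIm c1 in dIm.
  have [_ /(_ r) recRe_r] := recRe th; have [_ /(_ r) recIm_r] := recIm th.
  apply/eqP; rewrite eq_complex /polar Re_dilation Im_dilation dRe dIm.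
  by apply/andP; split; apply/eqP; [exact: recRe_r|exact: recIm_r].
have BfC0 : polar_C0 (polar (bispectrum f)).
  by exists (bispectrum f) => //; split; exact: C1_real_continuous.
have bij := id_sub_bij C00 C01.
split => //.
- by move=> omega; split; [have [] := meanRe omega|have [] := meanIm omega].
- move=> r th; split; rewrite ?gReE ?gImE.
    by have [+ _] := recRe th; apply.
  by have [+ _] := recIm th; apply.
- by rewrite dataE; exact: polar_C0_id_sub.
(* The data is the image under the operator of a member of [polar_C0], so injectivity there makes
   the partial inverse return that member. *)
- move=> r th; rewrite dataE /inverse_op pinvKV ?inE//.
  exact: id_sub_inj.
Qed.
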